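(* Let $\mathcal H=(V,E)$ be a locally finite simple hypergraph. Let $x,y\in V$ with $x\sim_{\mathcal H}y$. Then $$\kappa_{LLY}^{\mathcal H}(x,y)=\frac{\kappa_\alpha^{\mathcal H}(x,y)}{1-\alpha}\qquad\text{for all }\alpha\in\left[\frac12,1\right).$$ If moreover $\mathcal H$ is $r$-uniform and linear, then $$\kappa_{LLY}^{\mathcal H}(x,y)=\frac{\kappa_\alpha^{\mathcal H}(x,y)}{1-\alpha}\qquad\text{for all }\alpha\in\left[\frac{1}{\max\left(d_x^{\mathcal H},d_y^{\mathcal H}\right)(r-1)+1},1\right).$$
   Context: A hypergraph $\mathcal H=(V,E)$ consists of a vertex set $V$ and a set $E$ of finite subsets of $V$ (hyperedges). It is simple if $|e|\ge 2$ for every $e\in E$ and, for distinct $e,f\in E$, neither $e\subseteq f$ nor $f\subseteq e$. It is locally finite if each vertex belongs to only finitely many hyperedges; every hyperedge is finite. It is $r$-uniform if $|e|=r$ for all $e\in E$, and linear if any two distinct hyperedges have at most one vertex in common. The incidence degree of $x\in V$ is $d_x^{\mathcal H}:=\#\{e\in E: x\in e\}$. Two distinct vertices are adjacent, $x\sim_{\mathcal H}y$, if they lie in a common hyperedge. A hyperpath joining $u,v\in V$ is a finite sequence $(e_1,\dots,e_l)$ of distinct hyperedges with $u\in e_1$, $v\in e_l$ and $e_j\cap e_{j+1}\ne\varnothing$ for $1\le j\le l-1$. The distance $d_{\mathcal H}(u,v)$ is the minimum number $l$ of hyperedges in a hyperpath joining $u$ and $v$ ($\infty$ if none exists), and $d_{\mathcal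 H}(u,u)=0$. For finitely supported probability measures $\mu_1,\mu_2$ on $V$, the $1$-Wasserstein distance is $$W_1^{\mathcal H}(\mu_1,\mu_2):=\inf_{\pi}\sum_{u\in V}\sum_{v\in V}d_{\mathcal H}(u,v)\,\pi(u,v)$$ (with $\infty\cdot 0=0$), where the infimum is over all $\pi:V\times V\to[0,1]$ with $\sum_{w}\pi(u,w)=\mu_1(u)$ and $\sum_{w}\pi(w,v)=\mu_2(v)$ for all $u,v\in V$. For $x\in V$ and idleness $\alpha\in[0,1]$, the probability measure $\mu_x^\alpha$ on $V$ is defined by $\mu_x^\alpha(x)=\alpha$; $\mu_x^\alpha(z)=\frac{1-\alpha}{d_x^{\mathcal H}}\sum_{e\in E,\ e\supseteq\{x,z\}}\frac{1}{|e|-1}$ if $z\sim_{\mathcal H}x$; and $\mu_x^\alpha(z)=0$ otherwise. The $\alpha$-Ollivier--Ricci curvature is $$\kappa_\alpha^{\mathcal H}(x,y):=1-\frac{W_1^{\mathcal H}(\mu_x^\alpha,\mu_y^\alpha)}{d_{\mathcal H}(x,y)},$$ and the Lin--Lu--Yau curvature is $$\kappa_{LLY}^{\mathcal H}(x,y):=\lim_{\alpha\uparrow1}\frac{\kappa_\alpha^{\mathcal H}(x,y)}{1-\alpha}.$$ *)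

(* Defs.v *)
From HB Require Import structures.
From mathcomp Require Import all_boot all_order all_algebra.
From mathcomp Require Import finmap.
From mathcomp Require Import all_classical all_reals all_analysis.

Set Implicit Arguments.
Unset Strict Implicit.
Unset Printing Implicit Defensive.

Import Order.TTheory GRing.Theory Num.Theory.
Import numFieldNormedType.Exports.

Local Open Scope classical_set_scope.
Local Open Scope ring_scope.

(* The vertex set is the (possibly infinite) carrier V; a hypergraph is
   identified with its set of hyperedges. *)
Definition hypergraph (V : choiceType) := set {fset V}.

Section Hypergraphs.
Variable V : choiceType.
Implicit Types (E : hypergraph V) (x y u v : V).

Definition simple_hypergraph E : Prop :=
  (forall e, E e -> (2 <= #|` e|)%N) /\
  (forall e f, E e -> E f -> e <> f -> ~ (e `<=` f)%fset /\ ~ (f `<=` e)%fset).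

Definition locally_finite_hypergraph E : Prop :=
  forall x, finite_set [set e | E e /\ x \in e].

Definition uniform_hypergraph r E : Prop := forall e, E e -> #|` e| = r.

Definition linear_hypergraph E : Prop :=
  forall e f, E e -> E f -> e <> f -> (#|` (e `&` f)%fset| <= 1)%N.

(* Meaningful for locally finite E only: fset_set A is empty if A is
   infinite. *)
Definition incidence_degree E x : nat := #|` fset_set [set e | E e /\ x \in e]|.

Definition hyper_adjacent E x y : Prop :=
  x <> y /\ exists e, [/\ E e, x \in e & y \in e].

Definition hyperpath E u v (p : seq {fset V}) : Prop :=
  if p is e :: s then
    [/\ uniq p,
        forall f, f \in p -> E f,
        u \in e,
        v \in last e s
      & path (fun f g => (f `&` g)%fset != fset0) e s]
  else False.

Section Curvature.
Variable R : realType.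
Implicit Types (a : R) (m : V -> R).

(* The infimum of the empty set is +oo. *)
Definition hyper_dist E u v : \bar R :=
  if u == v then 0%E
  else ereal_inf [set ((size p)%:R)%:E | p in [set p | hyperpath E u v p]].

Definition coupling m1 m2 (pi : V -> V -> R) : Prop :=
  [/\ forall u v, 0 <= pi u v <= 1,
      forall u, \esum_(w in [set: V]) (pi u w)%:E = (m1 u)%:E
    & forall v, \esum_(w in [set: V]) (pi w v)%:E = (m2 v)%:E].

Definition wasserstein1 E m1 m2 : \bar R :=
  ereal_inf [set \esum_(u in [set: V]) \esum_(v in [set: V])
                   (hyper_dist E u v * (pi u v)%:E)%E
            | pi in [set pi | coupling m1 m2 pi]].

Definition idle_measure E a x : V -> R := fun z =>
  if z == x then a
  else if `[< hyper_adjacent E z x >] then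
    (1 - a) / (incidence_degree E x)%:R *
    \sum_(e \in [set e | E e /\ ([fset x; z] `<=` e)%fset])
       ((#|` e|%:R - 1)^-1 : R)
  else 0.

Definition kappa E a x y : \bar R :=
  (1 - wasserstein1 E (idle_measure E a x) (idle_measure E a y)
         / hyper_dist E x y)%E.

(* [lim] is a default value when the limit does not exist; an identity
   kappa_LLY = kappa a / (1 - a) for all a near 1 on the left makes the function
   constant there, so it entails that the limit exists. *)
Definition kappa_LLY E x y : \bar R :=
  lim ((kappa E a x y / (1 - a)%:E)%E @[a --> (1 : R)^'-]).

End Curvature.
End Hypergraphs.

(* Main.v *)
Require Import Defs.
From HB Require Import structures.
From mathcomp Require Import all_boot all_order all_algebra.
From mathcomp Require Import finmap.
From mathcomp Require Import all_classical all_reals all_analysis.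
From mathcomp Require Import ring lra.
Import Order.TTheory GRing.Theory Num.Theory.
Import numFieldNormedType.Exports.

Set Implicit Arguments.
Unset Strict Implicit.
Unset Printing Implicit Defensive.

Local Open Scope classical_set_scope.
Local Open Scope ring_scope.

(* For a <= b < 1 put s = (1 - b) / (1 - a), so that mu_x^b = s mu_x^a + (1 - s) delta_x.
   Moving the excess mass 1 - s from x to y turns a plan for a into a plan for b,
   whence W(b) <= s W(a) + (1 - s). The converse inequality, which makes
   kappa_a / (1 - a) constant, holds as soon as the cost of a plan for b can be
   kept while its mass at (x, y) is at least 1 - s. For a >= 1/2 every plan has
   this mass, since mu_y^b is a probability measure. For linear uniform
   hypergraphs with d_x >= d_y the exchange of two flows u -> y, x -> v against
   x -> y, u -> v achieves it: common neighbours z satisfy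
   mu_x^b(z) <= mu_y^b(z), so they can keep all their mass, and the remaining
   sources u of mass for y are at distance 2 from y. The case d_x < d_y follows
   by transposing plans. *)

(** * Transport plans on a finite set and their modification *)

Section TransportPlans.
Variables (R : realFieldType) (V : eqType) (F : seq V).
Hypothesis F_uniq : uniq F.
Implicit Types (m : V -> R) (c pi : V -> V -> R) (s t u v z : V).

(** Plans are functions on all of [V] that vanish off [F], so that they can be matched with
    couplings; the bound by 1 on the entries of a coupling is recovered from the marginals. *)
Definition plan m1 m2 pi : Prop :=
  [/\ forall u v, 0 <= pi u v,
      forall u v, ~~ ((u \in F) && (v \in F)) -> pi u v = 0,
      forall u, \sum_(v <- F) pi u v = m1 u
    & forall v, \sum_(u <- F) pi u v = m2 v].

Definition cost c pi : R := \sum_(u <- F) \sum_(v <- F) c u v * pi u v.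

Lemma sum_delta (f : V -> R) t :
  t \in F -> \sum_(v <- F) f v * (v == t)%:R = f t.
Proof.
move=> tF; rewrite (bigD1_seq t) //= eqxx mulr1 big1 ?addr0 // => v /negPf ->.
by rewrite mulr0.
Qed.

Lemma sum_delta1 t : t \in F -> \sum_(v <- F) (v == t)%:R = 1 :> R.
Proof.
by move=> tF; rewrite -[RHS](sum_delta (fun=> 1) tF); under [RHS]eq_bigr do rewrite mul1r.
Qed.

Lemma sum_except (f : V -> R) t :
  t \in F -> \sum_(v <- F) (if v == t then 0 else f v) = \sum_(v <- F) f v - f t.
Proof.
move=> tF; rewrite [in RHS](bigD1_seq t) //= [RHS]addrC addKr (bigD1_seq t) //=.
by rewrite eqxx add0r; apply: eq_bigr => v /negPf ->.
Qed.

Lemma term_le_sum (f : V -> R) t :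
  (forall v, 0 <= f v) -> t \in F -> f t <= \sum_(v <- F) f v.
Proof.
by move=> f0 tF; rewrite (bigD1_seq t) //= lerDl; apply: sumr_ge0.
Qed.

Lemma plan_tr m1 m2 pi : plan m1 m2 pi -> plan m2 m1 (fun u v => pi v u).
Proof. by case=> ? out ? ?; split=> // u v; rewrite andbC; exact: out. Qed.

Lemma cost_tr c pi : cost (fun u v => c v u) (fun u v => pi v u) = cost c pi.
Proof. exact: exchange_big. Qed.

Lemma plan_le1 m1 m2 pi u v : plan m1 m2 pi -> pi u v <= m1 u.
Proof.
move=> [pi0 out row col]; rewrite -row.
have [vF|vF] := boolP (v \in F); first exact: term_le_sum.
by rewrite out ?(negPf vF) ?andbF // sumr_ge0.
Qed.

Lemma plan_le2 m1 m2 pi u v : plan m1 m2 pi -> pi u v <= m2 v.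
Proof. by move=> /plan_tr /(plan_le1 v u). Qed.

(** Row [z] sums to [m1 z], so the diagonal entry exhausts it. *)
Lemma plan_diag_full m1 m2 pi z v :
  plan m1 m2 pi -> z \in F -> m1 z <= pi z z -> v != z -> pi z v = 0.
Proof.
move=> P zF mz vz; have [pi0 out row _] := P.
have [vF|vF] := boolP (v \in F); last by rewrite out ?(negPf vF) ?andbF.
have := @term_le_sum (fun v => if v == z then 0 else pi z v) v.
rewrite sum_except // row (negPf vz) => /(_ _ vF) le_v.
apply/eqP; rewrite eq_le pi0 andbT (le_trans (le_v _)) ?subr_le0 // => w.
by case: eqP.
Qed.

(* Reroute [p u] from [u -> t] to [u -> v] and [q v] from [s -> v] to [s -> t],
   pairing the two flows proportionally. *)
Lemma plan_swap c m1 m2 pi s t (p q : V -> R) :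
  plan m1 m2 pi -> s \in F -> t \in F ->
  (forall u, 0 <= p u <= pi u t) -> p s = 0 ->
  (forall v, 0 <= q v <= pi s v) -> q t = 0 ->
  \sum_(u <- F) p u = \sum_(v <- F) q v ->
  (forall u v, u \in F -> v \in F -> 0 < p u ->
     c u v + c s t <= c u t + c s v) ->
  exists pi', [/\ plan m1 m2 pi', cost c pi' <= cost c pi,
    pi' s t = pi s t + \sum_(u <- F) p u
  & forall u v, u != s -> v != t -> pi u v <= pi' u v].
Proof.
move=> [pi0 out row col] sF tF hp ps hq qt; set T := \sum_(u <- F) p u => qT cM.
have p0 u : 0 <= p u by case/andP: (hp u).
have q0 v : 0 <= q v by case/andP: (hq v).
have T0 : 0 <= T by apply: sumr_ge0.
have pout u : u \notin F -> p u = 0.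
  move=> uF; apply/eqP; rewrite eq_le p0 andbT.
  by have /andP[_] := hp u; rewrite (out u) // (negPf uF).
have qout v : v \notin F -> q v = 0.
  move=> uF; apply/eqP; rewrite eq_le q0 andbT.
  by have /andP[_] := hq v; rewrite (out s) // (negPf uF) andbF.
(* For [T = 0] both flows vanish, so the default value 0 of a division by 0 is the right one. *)
have pT u : p u * T / T = p u.
  have [T_eq0|T_neq0] := eqVneq T 0; last by rewrite mulfK.
  rewrite T_eq0 mulr0 mul0r; apply/esym/eqP; rewrite eq_le p0 andbT -T_eq0.
  by have [uF|/pout ->] := boolP (u \in F); first exact: term_le_sum p0 uF.
have qTT v : q v * T / T = q v.
  have [T_eq0|T_neq0] := eqVneq T 0; last by rewrite mulfK.
  rewrite T_eq0 mulr0 mul0r; apply/esym/eqP; rewrite eq_le q0 andbT -T_eq0 qT.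
  by have [vF|/qout ->] := boolP (v \in F); [exact: term_le_sum q0 vF | rewrite -qT].
have w0 u v : 0 <= p u * q v / T by rewrite divr_ge0 ?mulr_ge0.
have sum_wr u : \sum_(v <- F) p u * q v / T = p u.
  by rewrite -mulr_suml -mulr_sumr -qT pT.
have sum_wl v : \sum_(u <- F) p u * q v / T = q v.
  by rewrite -mulr_suml -mulr_suml -/T [T * _]mulrC qTT.
(* Both flows are removed and their total is added at [(s, t)]. The product weights [p u * q v / T]
   have marginals [p] and [q], which restores the remaining row and column sums. *)
pose pi' u v := pi u v - p u * (v == t)%:R - (u == s)%:R * q v
                + T * (u == s)%:R * (v == t)%:R + p u * q v / T.
exists pi'; split.
- split.
  + move=> u v; rewrite /pi'.
    have := w0 u v; have := pi0 u v.
    have := hp u; have := hq v.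
    have [->|us] := eqVneq u s; have [->|vt] := eqVneq v t;
      rewrite ?ps ?qt /= ?mulr0 ?mulr1 ?mul0r ?mul1r; lra.
  + move=> u v uvF; rewrite /pi' out //.
    have [uF|uF] := boolP (u \in F).
      move: uvF; rewrite uF /= => vF.
      have /negPf -> : v != t by apply: contraNneq vF => ->.
      by rewrite (qout v) // !(mulr0, mul0r, subr0, addr0).
    have /negPf -> : u != s by apply: contraNneq uF => ->.
    by rewrite pout // !(mulr0, mul0r, subr0, addr0).
  + move=> u; rewrite /pi' !big_split /= row sum_wr !sumrN sum_delta //.
    by rewrite -mulr_sumr -qT sum_delta //; ring.
  + move=> v; rewrite /pi' !big_split /= col sum_wl !sumrN -!mulr_suml -/T.
    by rewrite -mulr_sumr !sum_delta1 //; ring.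
(* All four corrections are written with the same weights, so the change of cost is a weighted sum
   of exchange defects, each nonpositive by [cM] wherever [p u > 0]. *)
- have -> : cost c pi' = cost c pi +
      \sum_(u <- F) \sum_(v <- F)
        (c u v + c s t - c u t - c s v) * (p u * q v / T).
    have eT : T = \sum_(u <- F) \sum_(v <- F) p u * q v / T.
      by under eq_bigr do rewrite sum_wr.
    rewrite /cost /pi'.
    transitivity (\sum_(u <- F) \sum_(v <- F) c u v * pi u v
      - \sum_(u <- F) c u t * p u - \sum_(v <- F) c s v * q v + c s t * T
      + \sum_(u <- F) \sum_(v <- F) c u v * (p u * q v / T)).
      have e1 : \sum_(u <- F) c u t * p u =
          \sum_(u <- F) \sum_(v <- F) c u v * (p u * (v == t)%:R).
        apply: eq_bigr => u _; rewrite -(sum_delta (fun v => c u v * p u)) //.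
        by apply: eq_bigr => v _; rewrite mulrA.
      have e2 : \sum_(v <- F) c s v * q v =
          \sum_(u <- F) \sum_(v <- F) c u v * ((u == s)%:R * q v).
        rewrite exchange_big /=; apply: eq_bigr => v _.
        rewrite -(sum_delta (fun u => c u v * q v)) //.
        by apply: eq_bigr => u _; rewrite -mulrA [q v * _]mulrC.
      have e3 : c s t * T =
          \sum_(u <- F) \sum_(v <- F) c u v * (T * (u == s)%:R * (v == t)%:R).
        rewrite -(sum_delta (fun u => c u t * T)) //.
        apply: eq_bigr => u _; rewrite -(sum_delta (fun v => c u v * T * (u == s)%:R)) //.
        by apply: eq_bigr => v _; rewrite !mulrA.
      rewrite e1 e2 e3 -!sumrB -!big_split /=; apply: eq_bigr => u _.
      rewrite -!sumrB -!big_split /=; apply: eq_bigr => v _; ring.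
    have e1 : \sum_(u <- F) c u t * p u =
        \sum_(u <- F) \sum_(v <- F) c u t * (p u * q v / T).
      by apply: eq_bigr => u _; rewrite -mulr_sumr sum_wr.
    have e2 : \sum_(v <- F) c s v * q v =
        \sum_(u <- F) \sum_(v <- F) c s v * (p u * q v / T).
      by rewrite exchange_big; apply: eq_bigr => v _; rewrite -mulr_sumr sum_wl.
    have e3 : c s t * T =
        \sum_(u <- F) \sum_(v <- F) c s t * (p u * q v / T).
      by rewrite [in LHS]eT mulr_sumr; apply: eq_bigr => u _; rewrite mulr_sumr.
    rewrite e1 e2 e3 -!sumrB -!big_split /=; apply: eq_bigr => u _.
    rewrite -!sumrB -!big_split /=; apply: eq_bigr => v _; ring.
  rewrite gerDl big_seq sumr_le0 // => u uF; rewrite big_seq sumr_le0 // => v vF.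
  have := p0 u; rewrite le_eqVlt => /orP[/eqP<-|pu]; first by rewrite !(mul0r, mulr0).
  by rewrite mulr_le0_ge0 //; have := cM u v uF vF pu; lra.
- by rewrite /pi' !eqxx ps qt !(mul0r, mulr0, mulr1, mul1r); ring.
- move=> u v /negPf us /negPf vt; rewrite /pi' us vt.
  by rewrite !(mulr0, mul0r, subr0, addr0) lerDl.
Qed.

(** The vertices are treated one at a time by [plan_swap] with [s = t = z]: flows [u -> z] and
    [z -> v] are short-cut to [u -> v], at no extra cost by the triangle inequality. Entries off row
    and column [z] do not decrease, so diagonal entries saturated earlier stay saturated. *)
Lemma plan_diag c m1 m2 pi (zs : seq V) :
  (forall u v z, u \in F -> v \in F -> z \in F -> c u v <= c u z + c z v) ->
  (forall z, c z z = 0) ->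
  plan m1 m2 pi -> {subset zs <= F} -> {in zs, forall z, m1 z <= m2 z} ->
  exists pi', [/\ plan m1 m2 pi', cost c pi' <= cost c pi
                & {in zs, forall z, m1 z <= pi' z z}].
Proof.
move=> ctri c0 P; elim: zs => [|z zs IH] zsF zsm; first by exists pi.
have [||pi1 [P1 le1 zs1]] := IH.
- by move=> w wzs; apply: zsF; rewrite inE wzs orbT.
- by move=> w wzs; apply: zsm; rewrite inE wzs orbT.
have zF : z \in F by apply: zsF; rewrite mem_head.
have mz : m1 z <= m2 z by apply: zsm; rewrite mem_head.
have [pi0 out row col] := P1.
(* [r] is what leaves [z] and [i] what enters it from elsewhere. Since [r <= i], scaling the
   incoming flow by [r / i] balances the two; [i = 0] forces [r = 0]. *)
set r := m1 z - pi1 z z; set i := m2 z - pi1 z z.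
have r0 : 0 <= r by rewrite subr_ge0 (plan_le1 _ _ P1).
have ri : r <= i by rewrite lerD2r.
have i0 : 0 <= i := le_trans r0 ri.
have ri1 : 0 <= r / i <= 1.
  rewrite divr_ge0 //=; have [->|i_neq0] := eqVneq i 0; first by rewrite invr0 mulr0.
  by rewrite ler_pdivrMr ?mul1r // lt_neqAle eq_sym i_neq0.
case/andP: (ri1) => ri_ge0 ri_le1.
pose p u := if u == z then 0 else pi1 u z * (r / i).
pose q v := if v == z then 0 else pi1 z v.
have sum_q : \sum_(v <- F) q v = r by rewrite sum_except // row.
have sum_p : \sum_(u <- F) p u = r.
  rewrite sum_except // -mulr_suml col -mulrBl -/i.
  have [i_eq0|i_neq0] := eqVneq i 0; last by rewrite mulrC divfK.
  by rewrite i_eq0 mul0r; lra.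
have [||||||pi' [P' le' st' mono']] :=
    @plan_swap c m1 m2 pi1 z z p q P1 zF zF.
- move=> u; rewrite /p; case: eqP => _; first by rewrite lexx pi0.
  by rewrite mulr_ge0 //= ler_piMr.
- by rewrite /p eqxx.
- by move=> v; rewrite /q; case: eqP => _; rewrite ?lexx pi0.
- by rewrite /q eqxx.
- by rewrite sum_p sum_q.
- by move=> u v uF vF _; rewrite c0 addr0; exact: ctri.
exists pi'; split=> //; first exact: le_trans le1.
move=> w; rewrite inE; have [-> _|wz /= wzs] := eqVneq w z.
  by rewrite st' sum_p /r addrC subrK.
exact: le_trans (zs1 w wzs) (mono' _ _ wz wz).
Qed.

(** All mass reaching [t] from sources other than [s] and [t] is replaced by mass from [s].
    Afterwards only [t] itself competes with [s], and it supplies at most [m1 t]. *)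
Lemma plan_fill c m1 m2 pi s t :
  plan m1 m2 pi -> s \in F -> t \in F -> s != t -> m2 t <= m1 s ->
  (forall u v, u \in F -> v \in F -> u != s -> u != t -> 0 < pi u t ->
     c u v + c s t <= c u t + c s v) ->
  exists pi', [/\ plan m1 m2 pi', cost c pi' <= cost c pi
                & m2 t - m1 t <= pi' s t].
Proof.
move=> P sF tF st mts cM; have [pi0 out row col] := P.
(* [T] is the mass to reroute and [J] what [s] sends elsewhere than to [t]; [m2 t <= m1 s] gives
   [T <= J], so the fraction [T / J] of the latter balances the exchange. *)
set T := m2 t - pi s t - pi t t; set J := m1 s - pi s t.
pose p u := if u == s then 0 else if u == t then 0 else pi u t.
pose q v := if v == t then 0 else pi s v * (T / J).
have sum_p : \sum_(u <- F) p u = T.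
  by rewrite sum_except // sum_except // (negPf st) col /T; ring.
have p0 u : 0 <= p u <= pi u t.
  by rewrite /p; do 2?[case: eqP => _]; rewrite ?lexx pi0.
have T0 : 0 <= T by rewrite -sum_p sumr_ge0 // => u _; case/andP: (p0 u).
have TJ : T <= J by rewrite /T /J; have := pi0 t t; lra.
have J0 : 0 <= J := le_trans T0 TJ.
have TJ_ge0 : 0 <= T / J by rewrite divr_ge0.
have TJ_le1 : T / J <= 1.
  have [->|J_neq0] := eqVneq J 0; first by rewrite invr0 mulr0.
  by rewrite ler_pdivrMr ?mul1r // lt_neqAle eq_sym J_neq0.
have sum_q : \sum_(v <- F) q v = T.
  rewrite sum_except // -mulr_suml row -mulrBl -/J.
  have [J_eq0|J_neq0] := eqVneq J 0; last by rewrite mulrC divfK.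
  by rewrite J_eq0 mul0r; lra.
have [|||||pi' [P' le' st' _]] := @plan_swap c m1 m2 pi s t p q P sF tF p0.
- by rewrite /p eqxx.
- move=> v; rewrite /q; case: eqP => _; first by rewrite lexx pi0.
  by rewrite mulr_ge0 //= ler_piMr.
- by rewrite /q eqxx.
- by rewrite sum_p sum_q.
- move=> u v uF vF; rewrite /p; case: eqVneq => us; first by rewrite ltxx.
  by case: eqVneq => ut; [rewrite ltxx | exact: cM].
exists pi'; split=> //.
by rewrite st' sum_p /T; have := plan_le1 t t P; lra.
Qed.

(** What [s] does not send to [t] must fit into the mass of [m2] outside [t]. *)
Lemma plan_total m1 m2 pi s t :
  plan m1 m2 pi -> s \in F -> t \in F ->
  m1 s + m2 t - \sum_(v <- F) m2 v <= pi s t.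
Proof.
move=> P sF tF; have [pi0 out row col] := P.
have : \sum_(v <- F) (if v == t then 0 else pi s v) <=
       \sum_(v <- F) (if v == t then 0 else m2 v).
  by apply: ler_sum => v _; case: eqP => // _; rewrite (plan_le2 _ _ P).
by rewrite !sum_except // row; lra.
Qed.

(* For [k > 1] mass is removed from [(s, t)], which is possible only if
   [k - 1 <= k * pi s t]. *)
Lemma plan_delta c m1 m2 n1 n2 pi s t (k : R) :
  plan m1 m2 pi -> s \in F -> t \in F -> 0 <= k ->
  k - 1 <= k * pi s t ->
  (forall u, n1 u = k * m1 u + (1 - k) * (u == s)%:R) ->
  (forall v, n2 v = k * m2 v + (1 - k) * (v == t)%:R) ->
  exists2 pi', plan n1 n2 pi' & cost c pi' = k * cost c pi + (1 - k) * c s t.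
Proof.
move=> [pi0 out row col] sF tF k0 kpi n1E n2E.
exists (fun u v => k * pi u v + (1 - k) * ((u == s)%:R * (v == t)%:R)).
  split.
  - move=> u v; have := mulr_ge0 k0 (pi0 u v).
    by case: eqVneq => [->|_]; case: eqVneq => [->|_]; rewrite /= ?(mulr0, mulr1); lra.
  - move=> u v uv; rewrite out // mulr0 add0r.
    have [us|] := eqVneq u s; have [vt|] := eqVneq v t; rewrite ?mulr0 ?mul0r ?mulr0 //.
    by move: uv; rewrite us vt sF tF.
  - move=> u; rewrite big_split /= -!mulr_sumr row n1E.
    by rewrite sum_delta1 // mulr1.
  - move=> v; rewrite big_split /= -!mulr_sumr col n2E.
    by rewrite -mulr_suml sum_delta1 // mul1r.
rewrite /cost mulr_sumr.
have -> : (1 - k) * c s t =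
    \sum_(u <- F) \sum_(v <- F) (1 - k) * c u v * (u == s)%:R * (v == t)%:R.
  under eq_bigr do rewrite sum_delta //.
  by rewrite sum_delta.
rewrite -big_split /=; apply: eq_bigr => u _; rewrite mulr_sumr -big_split /=.
by apply: eq_bigr => v _; ring.
Qed.

End TransportPlans.

(** * Distances through hyperpaths of bounded length *)

Section HypergraphDistance.
Variables (V : choiceType) (E : hypergraph V).
Implicit Types (u v z : V) (n : nat).

(** Stands for distance at most [n]. Equality is a separate case because [hyperpath] excludes the
    empty sequence. *)
Definition joined_within n u v : Prop :=
  u = v \/ exists2 p, hyperpath E u v p & (size p <= n)%N.

Lemma hyperpath_sym u v p : hyperpath E u v p -> hyperpath E v u (rev p).
Proof.
case: p => // e s [ps_uniq psE ue vs es].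
have revE : rev (e :: s) = last e s :: rev (belast e s).
  by rewrite lastI rev_rcons.
have last_rev : last (last e s) (rev (belast e s)) = e.
  by rewrite -[LHS](last_cons (last e s)) -revE rev_cons last_rcons.
rewrite /hyperpath revE -revE; split=> //.
- by rewrite rev_uniq.
- by move=> f; rewrite mem_rev; exact: psE.
- by rewrite last_rev.
- by rewrite rev_path; under eq_path => f g do rewrite fsetIC.
Qed.

Lemma joined_within_sym n u v : joined_within n u v -> joined_within n v u.
Proof.
move=> [->|[p pP pn]]; first by left.
by right; exists (rev p); rewrite ?size_rev //; exact: hyperpath_sym.
Qed.

(** A concatenation may repeat edges, which [hyperpath] forbids; [shortenP] extracts a path without
    repetition, whose length is bounded because its edges occur in the concatenation. *)
Lemma joined_within_trans m n u z v :
  joined_within m u z -> joined_within n z v -> joined_within (m + n) u v.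
Proof.
move=> [->|[p pP pm]] [<-|[q qP qn]]; first by left.
- by right; exists q => //; rewrite (leq_trans qn) ?leq_addl.
- by right; exists p => //; rewrite (leq_trans pm) ?leq_addr.
case: p q pP qP pm qn => [|e s] [|e' s'] // [_ psE ue zs es] [_ qE ze' vs' es'] pm qn.
have path_cat : path (fun f g => (f `&` g)%fset != fset0) e (s ++ e' :: s').
  rewrite cat_path es /= es' andbT; apply/fset0Pn; exists z.
  by rewrite inE zs ze'.
have last_cat' : last e (s ++ e' :: s') = last e' s' by rewrite last_cat.
right; move: last_cat'; case: (shortenP path_cat) => t et t_uniq ts lastt.
exists (e :: t).
  split=> //; last by rewrite lastt.
  move=> f; rewrite inE => /orP[/eqP->|/ts]; first by apply: psE; rewrite mem_head.
  rewrite mem_cat => /orP[fs|]; last exact: qE.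
  by apply: psE; rewrite inE fs orbT.
apply: leq_trans (leq_add pm qn); rewrite /= addSn ltnS.
have := uniq_leq_size _ ts; rewrite size_cat /=; apply.
by case/andP: t_uniq.
Qed.

Lemma joined_within_adjacent u v : u != v -> joined_within 1 u v <-> hyper_adjacent E u v.
Proof.
move=> uv; split=> [[uv_eq|[[|e [|f s]] // [_ eE ue ve _] _]]|].
- by rewrite uv_eq eqxx in uv.
- split; first exact/eqP.
  by exists e; split=> //; apply: eE; rewrite mem_head.
- move=> [_ [e [Ee ue ve]]]; right; exists [:: e] => //.
  by split=> // f; rewrite inE => /eqP->.
Qed.

Variable R : realType.

Lemma hyper_dist_sym u v : hyper_dist R E u v = hyper_dist R E v u.
Proof.
rewrite /hyper_dist eq_sym; case: eqP => // _; congr ereal_inf.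
by apply/seteqP; split=> _ [p /= pP <-]; exists (rev p);
  rewrite ?size_rev //; exact: hyperpath_sym.
Qed.

(** Lengths are natural numbers, so the infimum is attained as soon as the two vertices are
    joined. *)
Lemma hyper_distP n u v : joined_within n u v -> exists k,
  [/\ hyper_dist R E u v = k%:R%:E, joined_within k u v
    & forall m, joined_within m u v -> (k <= m)%N].
Proof.
move=> uvn; have ex : exists m, `[< joined_within m u v >] by exists n; apply/asboolP.
case: (ex_minnP ex) => k /asboolP uvk kmin.
have kmin' m : joined_within m u v -> (k <= m)%N by move/asboolP; exact: kmin.
exists k; split=> //; rewrite /hyper_dist; case: eqVneq => [uv|uv].
  by have := kmin' 0%N (or_introl uv); rewrite leqn0 => /eqP->.
apply/eqP; rewrite eq_le; apply/andP; split.
  case: uvk => [uv_eq|[p pP pk]]; first by rewrite uv_eq eqxx in uv.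
  apply: ereal_inf_lbound; exists p => //; congr (_%:R%:E); apply/eqP.
  by rewrite eqn_leq pk kmin' //; right; exists p.
apply: le_ereal_inf_tmp => _ [p /= pP <-]; rewrite lee_fin ler_nat kmin' //.
by right; exists p.
Qed.

(** [fine] sends an infinite distance to 0, hence the assumptions below that vertices are joined. *)
Definition hdist u v : R := fine (hyper_dist R E u v).

Lemma hdistE n u v : joined_within n u v -> hyper_dist R E u v = (hdist u v)%:E.
Proof. by move=> /hyper_distP[k [distE _ _]]; rewrite /hdist distE. Qed.

Lemma hdist_sym u v : hdist u v = hdist v u.
Proof. by rewrite /hdist hyper_dist_sym. Qed.

Lemma hdist_refl u : hdist u u = 0.
Proof. by rewrite /hdist /hyper_dist eqxx. Qed.

Lemma hdist_ge0 u v : 0 <= hdist u v.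
Proof.
rewrite fine_ge0 // /hyper_dist; case: eqP => // _.
by apply: le_ereal_inf_tmp => _ [p _ <-]; rewrite lee_fin.
Qed.

Lemma hdist_triangle m n u z v :
  joined_within m u z -> joined_within n z v -> hdist u v <= hdist u z + hdist z v.
Proof.
move=> /hyper_distP[k [uzE uzk _]] /hyper_distP[l [zvE zvl _]].
have uv := joined_within_trans uzk zvl.
have [j [uvE _ jmin]] := hyper_distP uv.
by rewrite /hdist uzE zvE uvE /= -natrD ler_nat jmin.
Qed.

Lemma hdist_adjacent u v : hyper_adjacent E u v -> hdist u v = 1.
Proof.
move=> uv; have uv_neq : u != v by case: uv => /eqP.
have uv1 : joined_within 1 u v by apply/joined_within_adjacent.
have [k [uvE uvk kmin]] := hyper_distP uv1; rewrite /hdist uvE /=.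
have := kmin _ uv1; case: k {kmin uvE} uvk => [[|[[|e s]] // ]|[|]] //.
by move=> uv_eq; rewrite uv_eq eqxx in uv_neq.
Qed.

Lemma hdist_ge2 n u v :
  joined_within n u v -> u != v -> ~ hyper_adjacent E u v -> 2 <= hdist u v.
Proof.
move=> uvn uv_neq uvN; have [k [uvE uvk _]] := hyper_distP uvn.
rewrite /hdist uvE /= (ler_nat _ 2); case: k {uvE} uvk => [|[|//]].
  by move=> [uv_eq|[[|e s]] //]; rewrite uv_eq eqxx in uv_neq.
by move=> /(joined_within_adjacent uv_neq).
Qed.

End HypergraphDistance.

(** * Idle measures as mixtures of a point mass and a jump law *)

Section IdleMeasure.
Variables (V : choiceType) (E : hypergraph V).
Hypotheses (hlf : locally_finite_hypergraph E) (hs : simple_hypergraph E).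
Implicit Types (x y z : V) (e : {fset V}).

Definition star x : {fset {fset V}} := fset_set [set e | E e /\ x \in e].

(** Local finiteness enters here: [fset_set] of an infinite set is empty. *)
Lemma in_star x e : reflect (E e /\ x \in e) (e \in star x).
Proof.
rewrite in_fset_set; last exact: hlf.
by apply: (iffP idP); rewrite inE.
Qed.

(** For adjacent [x] and [y] this finite set carries both idle measures and any two of its vertices
    are joined, so all transport takes place inside it. *)
Definition star_support x y : {fset V} :=
  (\bigcup_(e <- star x `|` star y) e)%fset.

Lemma star_supportP x y z :
  reflect (exists2 e, E e & (z \in e) && ((x \in e) || (y \in e)))
          (z \in star_support x y).
Proof.
apply: (iffP (bigfcupP _ _ _ _)) => [[e]|[e Ee /andP[ze xye]]].
  rewrite andbT inE => /orP[] /in_star[Ee xe] ze; exists e => //;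
  by rewrite ze xe ?orbT.
exists e => //; rewrite andbT inE; apply/orP.
by case/orP: xye => ?; [left|right]; apply/in_star.
Qed.

Lemma star_supportC x y : star_support x y = star_support y x.
Proof. by rewrite /star_support fsetUC. Qed.

Variable R : realType.

(* The one-step law of the simple random walk without idleness. *)
Definition jump x z : R :=
  if z == x then 0 else (incidence_degree E x)%:R^-1 *
    \sum_(e <- star x | z \in e) (#|` e|%:R - 1)^-1.

Lemma edge_weight_gt0 e : E e -> (0 : R) < #|` e|%:R - 1.
Proof. by move=> /hs.1 e2; rewrite subr_gt0 ltr1n. Qed.

Lemma jump_ge0 x z : 0 <= jump x z.
Proof.
rewrite /jump; case: eqP => // _; rewrite mulr_ge0 ?invr_ge0 //.
rewrite big_seq_cond sumr_ge0 // => e /andP[/in_star[Ee _] _].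
by rewrite invr_ge0 ltW ?edge_weight_gt0.
Qed.

Lemma jump_nonadjacent x z : z != x -> ~ hyper_adjacent E z x -> jump x z = 0.
Proof.
move=> zx zxN; rewrite /jump (negPf zx) big_seq_cond big_pred0 ?mulr0 // => e.
apply/negP => /andP[/in_star[Ee xe] ze]; apply: zxN; split; first exact/eqP.
by exists e.
Qed.

(** The form is affine in the idleness, which makes plans for different idleness comparable. *)
Lemma idle_measureE (a : R) x z :
  idle_measure E a x z = a * (z == x)%:R + (1 - a) * jump x z.
Proof.
rewrite /idle_measure; have [->|zx] := eqVneq z x.
  by rewrite /jump eqxx mulr0 addr0 mulr1.
rewrite mulr0 add0r; case: asboolP => [zxA|zxN]; last first.
  by rewrite jump_nonadjacent // mulr0.
rewrite /jump (negPf zx) mulrA; congr (_ * _).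
have -> : [set e | E e /\ ([fset x; z] `<=` e)%fset] =
          [set` [fset e in star x | z \in e]%fset].
  apply/seteqP; split => e /=.
    move=> [Ee /fsubsetP xze]; rewrite !inE /=; apply/andP; split.
      by apply/in_star; split=> //; apply: xze; rewrite !inE eqxx.
    by apply: xze; rewrite !inE eqxx orbT.
  rewrite !inE /= => /andP[/in_star[Ee xe] ze]; split=> //.
  by apply/fsubsetP => w; rewrite !inE => /orP[] /eqP->.
by rewrite fsbig_finite ?set_fsetK -?big_fset_condE //=; exact: finite_fset.
Qed.

(** After exchanging the sums, each edge [e] at [x] contributes [|e| - 1] vertices of weight
    [1 / (|e| - 1)], hence 1. *)
Lemma sum_jump x (F : {fset V}) :
  (0 < incidence_degree E x)%N -> (forall e, E e -> x \in e -> (e `<=` F)%fset) ->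
  \sum_(z <- F) jump x z = 1.
Proof.
move=> dx0 FE.
transitivity ((incidence_degree E x)%:R^-1 *
    \sum_(z <- F | z != x) \sum_(e <- star x | z \in e) (#|` e|%:R - 1)^-1 : R).
  rewrite mulr_sumr [RHS]big_mkcond; apply: eq_bigr => z _.
  by rewrite /jump; case: eqP.
rewrite (exchange_big_dep predT) //=.
transitivity ((incidence_degree E x)%:R^-1 * \sum_(e <- star x) (1 : R)); last first.
  by rewrite big_const_seq count_predT iter_addr_0 mulVf // pnatr_eq0 -lt0n.
congr (_ * _); apply: eq_big_seq => e /in_star[Ee xe].
(* [F] contains every edge at [x], so the vertices counted for [e] are all its vertices but [x]. *)
rewrite big_fset_condE /= (_ : [fset _ in _ | _]%fset = (e `\ x)%fset); last first.
  apply/fsetP => z; rewrite !inE /= andbA [in LHS]andbC.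
  have [ze|] := boolP (z \in e); last by rewrite andbF.
  by rewrite [z \in _](fsubsetP (FE e Ee xe) z ze) /= andbT.
rewrite big_const_seq count_predT iter_addr_0 -[X in _ *+ X]/(#|` (e `\ x)%fset|).
have eE : #|` e|%:R - 1 = #|` (e `\ x)%fset|%:R :> R.
  by rewrite (cardfsD1 x e) xe natrD addrAC subrr add0r.
by rewrite -[LHS]mulr_natl -eE divff // gt_eqF ?edge_weight_gt0.
Qed.

Lemma idle_measure_ge0 (a : R) x z : 0 <= a <= 1 -> 0 <= idle_measure E a x z.
Proof.
move=> /andP[a0 a1]; rewrite idle_measureE addr_ge0 ?mulr_ge0 ?jump_ge0 //.
by rewrite subr_ge0.
Qed.

Lemma sum_idle_measure (a : R) x (F : {fset V}) :
  (0 < incidence_degree E x)%N -> x \in F ->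
  (forall e, E e -> x \in e -> (e `<=` F)%fset) ->
  \sum_(z <- F) idle_measure E a x z = 1.
Proof.
move=> dx0 xF FE; under eq_bigr do rewrite idle_measureE.
rewrite big_split /= -!mulr_sumr sum_delta1 ?fset_uniq // sum_jump //.
by rewrite !mulr1 addrC subrK.
Qed.

(** By linearity a single edge passes through [x] and [z], so the inner sum has one term. *)
Lemma jump_linear_uniform (r : nat) x z :
  uniform_hypergraph r E -> linear_hypergraph E -> hyper_adjacent E z x ->
  jump x z = ((incidence_degree E x)%:R * (r%:R - 1))^-1.
Proof.
move=> hr hl [/eqP zx [e [Ee ze xe]]].
rewrite /jump (negPf zx) invfM; congr (_ * _).
have eS : e \in star x by apply/in_star.
rewrite big_seq_cond (big_rem e) //= ze eS /= big_seq_cond big_pred0 ?addr0 ?hr //.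
move=> f; apply/negP; rewrite rem_filter ?fset_uniq // mem_filter /=.
move=> /andP[/andP[fe _]] /andP[/in_star[Ef xf] zf].
have := hl e f Ee Ef (fun ef => negP fe (introT eqP (esym ef))).
rewrite leqNgt => /negP; apply; have := cardfs2 z x; rewrite zx => <-.
by apply: fsubset_leq_card; apply/fsubsetP => w; rewrite !inE => /orP[]/eqP->;
  rewrite ?ze ?zf ?xe ?xf.
Qed.

End IdleMeasure.

(** * Couplings on [V] as plans on a finite set *)

Section FiniteCouplings.
Variables (V : choiceType) (E : hypergraph V) (R : realType) (F : {fset V}).
Implicit Types (m : V -> R) (pi : V -> V -> R).

Lemma esum_finsupp (f : V -> R) :
  (forall u, 0 <= f u) -> (forall u, u \notin F -> f u = 0) ->
  \esum_(u in [set: V]) (f u)%:E = (\sum_(u <- F) f u)%:E.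
Proof.
move=> f0 fF; have -> : \esum_(u in [set: V]) (f u)%:E =
    \esum_(u in [set` F]) (f u)%:E.
  rewrite [RHS]esum_mkcond; apply: eq_esum => u _; case: ifPn => // uF.
  by rewrite fF //; apply: contra uF => uF; rewrite inE.
rewrite esum_fset //; last by move=> u _; rewrite lee_fin.
by rewrite fsbig_finite // set_fsetK sumEFin.
Qed.

(** Marginals vanishing off [F] force a coupling to vanish there; conversely the entries of a plan
    are at most [m1 u <= 1]. *)
Lemma coupling_plan m1 m2 pi :
  (forall u, u \notin F -> m1 u = 0) -> (forall v, v \notin F -> m2 v = 0) ->
  (forall u, m1 u <= 1) ->
  coupling m1 m2 pi <-> plan F m1 m2 pi.
Proof.
move=> m1F m2F m1_le1; split=> [[pi01 row col]|P].
- have pi0 u v : 0 <= pi u v by case/andP: (pi01 u v).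
  have term_le (f : V -> R) (s : R) v : (forall v, 0 <= f v) ->
      \esum_(w in [set: V]) (f w)%:E = s%:E -> f v <= s.
    move=> f0 fs; rewrite -lee_fin -fs; apply: esum_ge; exists [set v].
      by split=> //; exact: finite_set1.
    by rewrite fsbig_set1.
  have out u v : ~~ ((u \in F) && (v \in F)) -> pi u v = 0.
    move=> uv; apply/eqP; rewrite eq_le pi0 andbT.
    move: uv; rewrite negb_and => /orP[uF|vF].
      by rewrite -(m1F u uF); exact: (term_le (pi u)).
    by rewrite -(m2F v vF); exact: (term_le (pi^~ v)).
  split=> //.
  + move=> u; apply: EFin_inj; rewrite -row esum_finsupp // => v vF.
    by rewrite out // (negPf vF) andbF.
  + move=> v; apply: EFin_inj; rewrite -col (esum_finsupp (f := pi^~ v)) // => u uF.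
    by rewrite out // (negPf uF).
- have [pi0 out row col] := P; split.
  + move=> u v; rewrite pi0 (le_trans _ (m1_le1 u)) //.
    exact: (plan_le1 (fset_uniq F) u v P).
  + move=> u; rewrite esum_finsupp ?row // => v vF.
    by rewrite out // (negPf vF) andbF.
  + move=> v; rewrite (esum_finsupp (f := pi^~ v)) ?col // => u uF.
    by rewrite out // (negPf uF).
Qed.

(** Distances may be infinite off [F], but there the plan vanishes and [+oo * 0 = 0]. *)
Lemma esum_cost m1 m2 pi :
  {in F &, forall u v, exists n, joined_within E n u v} -> plan F m1 m2 pi ->
  (\esum_(u in [set: V]) \esum_(v in [set: V]) (hyper_dist R E u v * (pi u v)%:E))%E =
  (cost F (hdist E R) pi)%:E.
Proof.
move=> conn [pi0 out _ _].
have cpi0 u v : 0 <= hdist E R u v * pi u v by rewrite mulr_ge0 ?hdist_ge0.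
rewrite -(esum_finsupp (f := fun u => \sum_(v <- F) hdist E R u v * pi u v)).
- apply: eq_esum => u _; rewrite -esum_finsupp //.
  + apply: eq_esum => v _; rewrite EFinM.
    have [/andP[uF vF]|uv] := boolP ((u \in F) && (v \in F)).
      by have [n uvn] := conn u v uF vF; rewrite (hdistE _ uvn).
    by rewrite out // !mule0.
  + by move=> v vF; rewrite out ?mulr0 // (negPf vF) andbF.
- by move=> u; rewrite sumr_ge0.
- by move=> u uF; rewrite big1 // => v _; rewrite out ?mulr0 // (negPf uF).
Qed.

Lemma wasserstein_plan m1 m2 :
  (forall u, u \notin F -> m1 u = 0) -> (forall v, v \notin F -> m2 v = 0) ->
  (forall u, m1 u <= 1) -> {in F &, forall u v, exists n, joined_within E n u v} ->
  wasserstein1 E m1 m2 =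
  ereal_inf [set (cost F (hdist E R) pi)%:E | pi in plan F m1 m2].
Proof.
move=> m1F m2F m1_le1 conn; rewrite /wasserstein1; congr ereal_inf.
apply/seteqP; split=> _ [pi /= piP <-]; exists pi => //.
- exact/coupling_plan.
- by rewrite (@esum_cost m1 m2) //; exact/coupling_plan.
- exact/coupling_plan.
- by rewrite (@esum_cost m1 m2).
Qed.

End FiniteCouplings.

(** * Dependence of Wasserstein distance and curvature on the idleness *)

Section Curvature.
Variables (V : choiceType) (E : hypergraph V) (R : realType).
Hypotheses (hlf : locally_finite_hypergraph E) (hs : simple_hypergraph E).
Implicit Types (x y z : V) (a b : R).

Local Notation mu a x := (@idle_measure V R E a x).
Local Notation c := (hdist E R).

Lemma star_support_sub x y e :
  E e -> x \in e -> (e `<=` star_support E x y)%fset.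
Proof.
by move=> Ee xe; apply/fsubsetP => z ze; apply/star_supportP => //; exists e;
  rewrite ?ze ?xe.
Qed.

Lemma adjacent_sym x y : hyper_adjacent E x y -> hyper_adjacent E y x.
Proof. by move=> [xy [e [Ee xe ye]]]; split; [move/esym|exists e]. Qed.

Lemma adjacent_degree_gt0 x y :
  hyper_adjacent E x y -> (0 < incidence_degree E x)%N.
Proof.
move=> [_ [e [Ee xe _]]]; rewrite cardfs_gt0; apply/fset0Pn; exists e.
exact/in_star.
Qed.

Lemma adjacent_supportl x y : hyper_adjacent E x y -> x \in star_support E x y.
Proof. by move=> [_ [e [Ee xe _]]]; exact: fsubsetP (star_support_sub _ Ee xe) _ xe. Qed.

Lemma adjacent_supportr x y : hyper_adjacent E x y -> y \in star_support E x y.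
Proof. by move=> /adjacent_sym /adjacent_supportl; rewrite star_supportC. Qed.

Lemma within_support x y z : hyper_adjacent E x y -> z \in star_support E x y ->
  exists n, joined_within E n x z.
Proof.
move=> xy /star_supportP-/(_ hlf)[e Ee /andP[ze xye]].
have step w : w \in e -> joined_within E 1 w z.
  move=> we; have [->|wz] := eqVneq w z; first by left.
  by apply/joined_within_adjacent => //; split; [exact/eqP|exists e].
case/orP: xye => [/step xz|/step yz]; first by exists 1%N.
exists 2%N; apply: (joined_within_trans (m := 1) _ yz).
apply/joined_within_adjacent => //.
by case: xy => /eqP.
Qed.

Lemma support_connected x y : hyper_adjacent E x y ->
  {in star_support E x y &, forall u v, exists n, joined_within E n u v}.
Proof.
move=> xy u v /(within_support xy)[m xu] /(within_support xy)[n xv].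
by exists (m + n)%N; exact: joined_within_trans (joined_within_sym xu) xv.
Qed.

Lemma idle_measure_out a x y z : hyper_adjacent E x y ->
  z \notin star_support E x y -> mu a x z = 0.
Proof.
move=> xy zF; have zx : z != x.
  by apply: contraNneq zF => ->; exact: adjacent_supportl.
rewrite idle_measureE // (negPf zx) mulr0 add0r jump_nonadjacent ?mulr0 //.
move=> [_ [e [Ee ze xe]]]; move/negP: zF; apply.
exact: fsubsetP (star_support_sub _ Ee xe) _ ze.
Qed.

Lemma idle_measure_total a x y : hyper_adjacent E x y ->
  \sum_(z <- star_support E x y) mu a x z = 1.
Proof.
move=> xy; rewrite sum_idle_measure //.
- exact: adjacent_degree_gt0 xy.
- exact: adjacent_supportl.
- by move=> e; exact: star_support_sub.
Qed.

Lemma idle_measure_le1 a x y z : hyper_adjacent E x y -> 0 <= a <= 1 ->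
  mu a x z <= 1.
Proof.
move=> xy a01; have mu0 := fun z => idle_measure_ge0 hlf hs x z a01.
have [zF|/(idle_measure_out _ xy) -> //] := boolP (z \in star_support E x y).
rewrite -(idle_measure_total a xy); exact: term_le_sum mu0 zF.
Qed.

(* The plan moving a unit of mass from [x] to [y] interpolates the plans for
   [a] towards idleness 1; conversely it can be subtracted from any plan for [b]
   with enough mass at [(x, y)]. *)
Lemma wasserstein_affine x y a b : hyper_adjacent E x y -> 0 <= a -> a <= b < 1 ->
  (forall pi, plan (star_support E x y) (mu b x) (mu b y) pi ->
     exists pi', [/\ plan (star_support E x y) (mu b x) (mu b y) pi',
       cost (star_support E x y) c pi' <= cost (star_support E x y) c pi
     & (b - a) / (1 - a) <= pi' x y]) ->
  wasserstein1 E (mu b x) (mu b y) =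
  (((1 - b) / (1 - a))%:E * wasserstein1 E (mu a x) (mu a y)
   + (1 - (1 - b) / (1 - a))%:E)%E.
Proof.
move=> xy a0 /andP[ab b1] good; set s := (1 - b) / (1 - a).
have a1 : a < 1 := le_lt_trans ab b1.
have s0 : 0 < s by rewrite divr_gt0 ?subr_gt0.
have a1_neq0 : 1 - a != 0 by rewrite subr_eq0 gt_eqF.
have b1_neq0 : 1 - b != 0 by rewrite subr_eq0 gt_eqF.
set F := star_support E x y in good *.
have yx := adjacent_sym xy.
have xF : x \in F := adjacent_supportl xy.
have yF : y \in F := adjacent_supportr xy.
have WE d : 0 <= d <= 1 -> wasserstein1 E (mu d x) (mu d y) =
    ereal_inf [set (cost F c pi)%:E | pi in plan F (mu d x) (mu d y)].
  move=> d01; apply: wasserstein_plan => [u uF|v vF|u|].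
  - exact: idle_measure_out xy uF.
  - by apply: (idle_measure_out _ yx); rewrite star_supportC.
  - exact: idle_measure_le1 xy d01.
  - exact: support_connected.
have cxy : c x y = 1 := hdist_adjacent _ xy.
have muE w z : mu b w z = s * mu a w z + (1 - s) * (z == w)%:R.
  by rewrite !idle_measureE // /s; field.
have muEV w z : mu a w z = s^-1 * mu b w z + (1 - s^-1) * (z == w)%:R.
  by rewrite muE; field; rewrite gt_eqF.
rewrite !WE ?a0 ?(ltW a1) ?(le_trans a0 ab) ?(ltW b1) //.
apply/eqP; rewrite eq_le; apply/andP; split.
(* Upper bound, with [k = s <= 1]: the mass condition of [plan_delta] holds for every plan. *)
- rewrite -leeBlDr // -lee_pdivrMl //; apply: le_ereal_inf_tmp => _ [pi piP <-].
  have kpi : s - 1 <= s * pi x y.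
    have [pi0 _ _ _] := piP; apply: le_trans (mulr_ge0 (ltW s0) (pi0 x y)).
    by rewrite subr_le0 ler_pdivrMr ?subr_gt0 // mul1r lerB.
  have [pi' piP' cost'] := @plan_delta _ _ _ (fset_uniq F) c _ _ _ _ _ x y s piP
    xF yF (ltW s0) kpi (muE x) (muE y).
  rewrite lee_pdivrMl // leeBlDr // -EFinM -EFinD.
  apply: ereal_inf_lbound; exists pi' => //.
  by rewrite cost' cxy mulr1.
(* Lower bound, with [k = s^-1 >= 1]: as [1 - s = (b - a) / (1 - a)], the mass provided by [good] is
   exactly what [plan_delta] requires. *)
- apply: le_ereal_inf_tmp => _ [pi piP <-].
  have [pi1 [piP1 le1 xy1]] := good pi piP.
  have kpi : s^-1 - 1 <= s^-1 * pi1 x y.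
    rewrite -ler_pdivrMl ?invr_gt0 // invrK mulrBr mulfV ?gt_eqF // mulr1.
    apply: le_trans xy1; rewrite le_eqVlt; apply/orP; left; apply/eqP.
    by rewrite /s; field.
  have si0 : 0 <= s^-1 by rewrite invr_ge0 ltW.
  have [pi' piP' cost'] := @plan_delta _ _ _ (fset_uniq F) c _ _ _ _ _ x y s^-1 piP1
    xF yF si0 kpi (muEV x) (muEV y).
  apply: (@le_trans _ _ (s%:E * (cost F c pi')%:E + (1 - s)%:E)%E).
    rewrite leeD2r // lee_pmul2l //; apply: ereal_inf_lbound.
    by exists pi'.
  rewrite -EFinM -EFinD lee_fin; apply: le_trans le1.
  rewrite cost' cxy mulr1 le_eqVlt; apply/orP; left; apply/eqP.
  by field; rewrite gt_eqF.
Qed.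

(** Since [x] and [y] are at distance 1, the affine formula says that [kappa] at [b] is
    [(1 - b) / (1 - a)] times [kappa] at [a]. The quotient is therefore constant on [[a, 1)], and
    its limit is that constant. *)
Lemma kappa_LLY_affine x y a : hyper_adjacent E x y -> 0 <= a < 1 ->
  (forall b, a <= b < 1 -> wasserstein1 E (mu b x) (mu b y) =
     (((1 - b) / (1 - a))%:E * wasserstein1 E (mu a x) (mu a y)
      + (1 - (1 - b) / (1 - a))%:E)%E) ->
  kappa_LLY R E x y = (kappa E a x y / (1 - a)%:E)%E.
Proof.
move=> xy /andP[a0 a1] affine; rewrite /kappa_LLY; apply: lim_near_cst => //.
near=> b.
have b1 : b < 1 by near: b; exact: nbhs_left_lt.
have ab : a <= b by near: b; exact: nbhs_left_ge.
have a1_neq0 : 1 - a != 0 by rewrite subr_eq0 gt_eqF.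
have b1_neq0 : 1 - b != 0 by rewrite subr_eq0 gt_eqF.
have [n dist_fin] : exists n, joined_within E n x y.
  by exists 1%N; apply/joined_within_adjacent => //; case: xy => /eqP.
rewrite /kappa (hdistE _ dist_fin) hdist_adjacent // affine ?ab //.
have : (0 <= wasserstein1 E (mu a x) (mu a y))%E.
  apply: le_ereal_inf_tmp => _ [pi [pi01 _ _] <-].
  apply: esum_ge0 => u _; apply: esum_ge0 => v _; rewrite mule_ge0 //.
    rewrite /hyper_dist; case: eqP => // _.
    by apply: le_ereal_inf_tmp => _ [p _ <-]; rewrite lee_fin.
  by rewrite lee_fin; case/andP: (pi01 u v).
rewrite !inver (negPf a1_neq0) (negPf b1_neq0) oner_eq0.
case: (wasserstein1 E (mu a x) (mu a y)) => [w _|_|//].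
- by rewrite -!(EFinM, EFinD, EFinN); congr (_%:E); field; rewrite a1_neq0.
(* A Wasserstein distance [+oo] makes both quotients [-oo]; the value [-oo] is excluded by
   nonnegativity. *)
- rewrite gt0_muley ?lte_fin ?divr_gt0 ?subr_gt0 // addye // invr1 !mule1 /=.
  by rewrite !gt0_mulNye ?lte_fin ?invr_gt0 ?subr_gt0.
Unshelve. all: by end_near. Qed.

(** Of the mass [b] at [x], at most [1 - b] can avoid [y], so every plan moves at least [2 * b - 1]
    from [x] to [y]. *)
Lemma plan_idle_half x y a b pi : hyper_adjacent E x y -> 1 / 2 <= a -> a <= b < 1 ->
  plan (star_support E x y) (mu b x) (mu b y) pi -> (b - a) / (1 - a) <= pi x y.
Proof.
move=> xy a2 /andP[ab b1] piP.
have yx := adjacent_sym xy.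
have := plan_total (fset_uniq _) piP (adjacent_supportl xy) (adjacent_supportr xy).
have -> : \sum_(v <- star_support E x y) mu b y v = 1.
  by rewrite star_supportC idle_measure_total.
rewrite !idle_measureE // /jump !eqxx !mulr1 !mulr0 !addr0.
apply: le_trans; rewrite ler_pdivrMr; last by lra.
(* The two sides differ by [(1 - b) * (2 * a - 1)]. *)
nra.
Qed.

(* First saturate the diagonal at the common neighbours; afterwards every other
   vertex still sending mass to [y] is at distance at least 2 from [y], so
   routing that mass from [x] instead does not increase the cost. *)
Lemma plan_idle_improve x y b pi : hyper_adjacent E x y -> 0 <= b < 1 ->
  (forall z, hyper_adjacent E z x -> hyper_adjacent E z y ->
     jump E R x z <= jump E R y z) ->
  plan (star_support E x y) (mu b x) (mu b y) pi ->
  exists pi', [/\ plan (star_support E x y) (mu b x) (mu b y) pi',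
    cost (star_support E x y) c pi' <= cost (star_support E x y) c pi
  & b - (1 - b) * jump E R x y <= pi' x y].
Proof.
move=> xy /andP[b0 b1] common; set F := star_support E x y => piP.
have yx := adjacent_sym xy.
have xF : x \in F := adjacent_supportl xy.
have yF : y \in F := adjacent_supportr xy.
have xy_neq : x != y by case: xy => /eqP.
have yx_neq : y != x by rewrite eq_sym.
have conn := support_connected xy.
have tri : forall u v z, u \in F -> v \in F -> z \in F -> c u v <= c u z + c z v.
  move=> u v z uF vF zF; have [m uz] := conn _ _ uF zF; have [n zv] := conn _ _ zF vF.
  exact: hdist_triangle uz zv.
pose zs := [seq z <- F | `[< hyper_adjacent E z x /\ hyper_adjacent E z y >]].
have [|||pi1 [piP1 le1 diag1]] := @plan_diag _ _ _ (fset_uniq F) c _ _ pi zs tri _ piP.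
- exact: hdist_refl.
- by move=> z; rewrite mem_filter => /andP[].
- move=> z; rewrite mem_filter => /andP[/asboolP[zx zy] _].
  have /negPf zx_neq : z != x by case: zx => /eqP.
  have /negPf zy_neq : z != y by case: zy => /eqP.
  by rewrite !idle_measureE // zx_neq zy_neq lerD2l ler_wpM2l ?subr_ge0 ?(ltW b1) ?common.
have [||pi' [piP' le' xy']] :=
    @plan_fill _ _ _ (fset_uniq F) c _ _ pi1 x y piP1 xF yF xy_neq.
(* Both idle masses equal [b], so the capacity condition of [plan_fill] is an equality. *)
- rewrite !idle_measureE // /jump !eqxx !mulr1 !mulr0 //.
- move=> u v uF vF ux uy pi1uy.
  have ux_adj : hyper_adjacent E u x.
    apply/not_notP => uxN; move: pi1uy; rewrite ltNge => /negP; apply.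
    apply: le_trans (plan_le1 (fset_uniq F) u y piP1) _.
    by rewrite idle_measureE // (negPf ux) jump_nonadjacent // !mulr0 addr0.
  (* A common neighbour has been saturated on the diagonal and sends nothing to [y]. *)
  have uy_nadj : ~ hyper_adjacent E u y.
    move=> uy_adj; have uzs : u \in zs by rewrite mem_filter uF andbT; apply/asboolP.
    have := plan_diag_full (fset_uniq F) piP1 uF (diag1 u uzs) (_ : y != u).
    by rewrite eq_sym => /(_ uy) pi1_eq0; rewrite pi1_eq0 ltxx in pi1uy.
  have [n uyn] := conn _ _ uF yF.
  (* With [c u y >= 2] and [c x y = c u x = 1], the exchange inequality follows from
     [c u v <= c u x + c x v]. *)
  rewrite (hdist_adjacent R xy).
  have := hdist_ge2 R uyn uy uy_nadj; have := tri u v x uF vF xF.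
  by rewrite (hdist_adjacent R ux_adj); lra.
exists pi'; split=> //; first exact: le_trans le1.
apply: le_trans xy'; rewrite !idle_measureE // (negPf yx_neq) /jump !eqxx.
by rewrite !mulr1 !mulr0 addr0 add0r.
Qed.

(** The reversed comparison of jumps is handled by exchanging [x] and [y]: transposing a plan keeps
    its cost because the distance is symmetric. *)
Lemma plan_idle_improve_max x y b pi : hyper_adjacent E x y -> 0 <= b < 1 ->
  (forall z, hyper_adjacent E z x -> hyper_adjacent E z y ->
     jump E R y z <= jump E R x z) ->
  plan (star_support E x y) (mu b x) (mu b y) pi ->
  exists pi', [/\ plan (star_support E x y) (mu b x) (mu b y) pi',
    cost (star_support E x y) c pi' <= cost (star_support E x y) c pi
  & b - (1 - b) * jump E R y x <= pi' x y].
Proof.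
move=> xy b01 common piP; have yx := adjacent_sym xy.
have cost_sym pi0 : cost (star_support E x y) c (fun u v => pi0 v u) =
                    cost (star_support E x y) c pi0.
  rewrite -cost_tr; apply: eq_bigr => u _; apply: eq_bigr => v _.
  by rewrite hdist_sym.
have piT := plan_tr piP; rewrite star_supportC in cost_sym piT *.
have [|pi' [piP' le' yx']] := plan_idle_improve yx b01 _ piT.
  by move=> z zy zx; exact: common.
exists (fun u v => pi' v u); split=> //.
  exact: (plan_tr piP').
by rewrite cost_sym -[leRHS]cost_sym.
Qed.

End Curvature.

(** * The two ranges of idleness *)

Theorem corollary1p5 (R : realType) (V : choiceType) (E : hypergraph V)
    (hlf : locally_finite_hypergraph E) (hs : simple_hypergraph E)
    (x y : V) (hxy : hyper_adjacent E x y) :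
  (forall a : R, 1 / 2 <= a < 1 ->
     kappa_LLY R E x y = (kappa E a x y / (1 - a)%:E)%E) /\
  (forall r : nat, uniform_hypergraph r E -> linear_hypergraph E ->
     forall a : R,
       1 / ((maxn (incidence_degree E x) (incidence_degree E y))%:R * (r%:R - 1) + 1) <= a < 1 ->
       kappa_LLY R E x y = (kappa E a x y / (1 - a)%:E)%E).
Proof.
split=> [a /andP[a2 a1]|r hr hl a /andP[aD a1]].
  have a0 : 0 <= a by lra.
  apply: kappa_LLY_affine => //; first by rewrite a0.
  move=> b ab1; apply: wasserstein_affine => // pi piP.
  by exists pi; split=> //; exact: plan_idle_half piP.
set D := maxn _ _ in aD.
have hyx := adjacent_sym hxy.
have dx0 := adjacent_degree_gt0 hlf hxy.
have dy0 := adjacent_degree_gt0 hlf hyx.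
have r1 : 0 < r%:R - 1 :> R.
  by have [_ [e [Ee _ _]]] := hxy; rewrite -(hr e Ee) (edge_weight_gt0 hs).
have D0 : 0 < D%:R :> R by rewrite ltr0n leq_max dx0.
have N0 : 0 < D%:R * (r%:R - 1) :> R by rewrite mulr_gt0.
have a0 : 0 <= a.
  by apply: le_trans aD; rewrite divr_ge0 // addr_ge0 // ltW.
have jump_le u v z : hyper_adjacent E z u -> hyper_adjacent E z v ->
    (incidence_degree E v <= incidence_degree E u)%N ->
    (0 < incidence_degree E v)%N -> jump E R u z <= jump E R v z.
  move=> zu zv vu v0; rewrite !(jump_linear_uniform hlf R hr hl) //.
  have u0 := leq_trans v0 vu.
  by rewrite lef_pV2 ?posrE ?mulr_gt0 ?ltr0n // ler_pM2r // ler_nat.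
(* With [N = D * (r - 1)], the right side minus the left is [(1 - b) * (a / (1 - a) - 1 / N)], and
   the lower bound on [a] says exactly that [(1 - a) / N <= a]. *)
have bound b : a <= b < 1 ->
    (b - a) / (1 - a) <= b - (1 - b) * (D%:R * (r%:R - 1))^-1.
  move=> /andP[ab b1]; rewrite ler_pdivrMr ?subr_gt0 //.
  move: aD; rewrite ler_pdivrMr ?ltr_wpDr // => aD.
  set N := D%:R * (r%:R - 1) in N0 aD *.
  have : (1 - a) * N^-1 <= a by rewrite ler_pdivrMr //; lra.
  move=> Na; nra.
apply: kappa_LLY_affine => //; first by rewrite a0.
move=> b ab1; have b01 : 0 <= b < 1.
  by case/andP: ab1 => ab ->; rewrite (le_trans a0 ab).
apply: wasserstein_affine => // pi piP.
(* The vertex of larger degree has the smaller jumps to common neighbours. In either case the jump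
   in the resulting bound starts at this vertex, whose degree is [D]. *)
have [yx|xy] := leqP (incidence_degree E y) (incidence_degree E x).
  have [|pi' [piP' le' xy']] := plan_idle_improve hlf hxy b01 _ piP.
    by move=> z zx zy; exact: jump_le.
  exists pi'; split=> //; apply: le_trans xy'.
  rewrite (jump_linear_uniform hlf R hr hl hyx).
  by rewrite -[incidence_degree E x](maxn_idPl yx) bound.
have [|pi' [piP' le' xy']] := plan_idle_improve_max hlf hxy b01 _ piP.
  by move=> z zx zy; apply: jump_le => //; exact: ltnW.
exists pi'; split=> //; apply: le_trans xy'.
rewrite (jump_linear_uniform hlf R hr hl hxy).
by rewrite -[incidence_degree E y](maxn_idPr (ltnW xy)) bound.
Qed.
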